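(* Let $K$ be a reproducing kernel on $\mathbb{B}^n$, $R_1,\dots,R_N\in SO(n)$, $\mathbf{x}_1,\dots,\mathbf{x}_M\in\mathbb{B}^{n-1}$, $\nu>0$, and let $\hat f^\nu=\sum_{i=1}^N\sum_{j=1}^M\hat\alpha^\nu_{ij}\mathcal{P}_{R_i}^*\tilde k^{R_i}_{\mathbf{x}_j}$ be the Tikhonov regularized reconstruction from data $y_{ij}$. It produces an interpolation of the projection images as follows: for any $R\in SO(n)$ and $\mathbf{x}\in\mathbb{B}^{n-1}$, $$\mathcal{P}\hat f^\nu(R,\mathbf{x})=\langle\mathcal{P}_R^*\tilde k^R_{\mathbf{x}},\hat f^\nu\rangle_{\mathbb{H}(K)}=\sum_{i=1}^N\sum_{j=1}^M\hat\alpha^\nu_{ij}\langle\mathcal{P}_R^*\tilde k^R_{\mathbf{x}},\mathcal{P}_{R_i}^*\tilde k^{R_i}_{\mathbf{x}_j}\rangle_{\mathbb{H}(K)}.$$ Furthermore, the interpolant $\mathcal{P}\hat f^\nu$ (with $\mathcal{P}\hat f^\nu(R,\cdot)\in\mathbb{H}(\tilde K^R)$) is a bona fide sinogram, i.e. it satisfies the Helgason–Ludwig consistency conditions: for any $l\in\{0,1,2,\dots\}$ and $R\in SO(n)$, $$\int_{\mathbb{B}^{n-1}}(\mathbf{x}^\top\mathbf{y})^l\,\mathcal{P}\hat f^\nu(R,\mathbf{x})\,d\mathbf{x}=q_l^\nu(\mathbf{P}_R^*(\mathbf{y})),\qquad\mathbf{y}\in\mathbb{R}^{n-1},$$ where $q_l^\nu(\cdot):=\int_{\mathbb{B}^n}(\mathbf{z}^\top\cdot)^l\hat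 f^\nu(\mathbf{z})\,d\mathbf{z}$ is a homogeneous polynomial of degree $l$ on $\mathbb{R}^n$, independent of $R\in SO(n)$.
   Context: Throughout $n\ge2$. $\mathbb{B}^m$ is the closed unit ball of $\mathbb{R}^m$; $[\mathbf{x}:z]\in\mathbb{R}^n$ is the concatenation of $\mathbf{x}\in\mathbb{R}^{n-1}$ and $z\in\mathbb{R}$; $I_{\|\mathbf{x}\|}:=[-\sqrt{1-\|\mathbf{x}\|^2},\sqrt{1-\|\mathbf{x}\|^2}]$. A reproducing kernel $K$ on a set is a real symmetric positive semidefinite function, $\mathbb{H}(K)$ its RKHS of real functions. For $R\in SO(n)$: $\mathcal{P}f(R,\mathbf{x})=\mathcal{P}_Rf(\mathbf{x})=\int_{I_{\|\mathbf{x}\|}}f(R^\top[\mathbf{x}:z])\,dz$ (X-ray transform); $\tilde K^R(\mathbf{x}_1,\mathbf{x}_2)=\int_{I_{\|\mathbf{x}_2\|}}\int_{I_{\|\mathbf{x}_1\|}}K(R^\top[\mathbf{x}_1:z_1],R^\top[\mathbf{x}_2:z_2])\,dz_1dz_2$ (induced kernel on $\mathbb{B}^{n-1}$); all integrals are assumed to exist, as is automatic for continuous $K$; $\tilde k^R_{\mathbf{x}}=\tilde K^R(\cdot,\mathbf{x})$. $\mathcal{P}_R:\mathbb{H}(K)\to\mathbb{H}(\tilde K^R)$ is a bounded operator with Hilbert adjoint $\mathcal{P}_R^*$. The Euclidean projection $\mathbf{P}_R:\mathbb{R}^n\to\mathbb{R}^{n-1}$ maps $\mathbf{z}$ to the first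 $n-1$ coordinates of $R\mathbf{z}$, and $\mathbf{P}_R^*(\mathbf{y})=R^\top[\mathbf{y}:0]$. Tikhonov reconstruction: with $\mathbf{W}=[\langle\mathcal{P}_{R_i}^*\tilde k^{R_i}_{\mathbf{x}_j},\mathcal{P}_{R_{i'}}^*\tilde k^{R_{i'}}_{\mathbf{x}_{j'}}\rangle_{\mathbb{H}(K)}]\in\mathbb{R}^{NM\times NM}$ and $\mathbf{Y}=\mathrm{vec}[y_{ij}]$, $\hat{\boldsymbol\alpha}^\nu=(\mathbf{W}+\nu\mathbf{I})^{-1}\mathbf{Y}$; $\hat f^\nu$ is the unique minimizer over $\mathbb{H}(K)$ of $\sum_{i,j}(y_{ij}-\mathcal{P}_{R_i}f(\mathbf{x}_j))^2+\nu\|f\|^2_{\mathbb{H}(K)}$. Helgason–Ludwig consistency conditions for a function $g(R,\mathbf{x})$ on $SO(n)\times\mathbb{B}^{n-1}$: (i) (compatibility) if $R_1^\top e_n=\pm R_2^\top e_n$ and $\mathbf{P}_{R_1}^*(\mathbf{x}_1)=\mathbf{P}_{R_2}^*(\mathbf{x}_2)$ then $g(R_1,\mathbf{x}_1)=g(R_2,\mathbf{x}_2)$; (ii) (moment condition) for each integer $l\ge0$ there is a homogeneous polynomial $q_l$ of degree $l$ on $\mathbb{R}^n$, independent of $R$, with $\int(\mathbf{x}^\top\mathbf{y})^lg(R,\mathbf{x})\,d\mathbf{x}=q_l(\mathbf{P}_R^*(\mathbf{y}))$ for all $\mathbf{y}\in\mathbb{R}^{n-1}$. *)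

(* Defs.v *)
From HB Require Import structures.
From mathcomp Require Import all_boot all_order all_algebra.
From mathcomp Require Import -(notations) mpoly.
From mathcomp Require Import ring.
From mathcomp Require Import all_classical all_reals all_analysis.

Set Implicit Arguments.
Unset Strict Implicit.
Unset Printing Implicit Defensive.
Import Order.TTheory GRing.Theory Num.Theory.
Import numFieldNormedType.Exports.

Local Open Scope classical_set_scope.
Local Open Scope ring_scope.

Definition measure_matrix_display : measure_display -> measure_display.
Proof. exact. Qed.

Section measurable_matrix.
Context {d} {T : measurableType d} (m n : nat).

(* The sigma-algebra generated by the entries; on 'cV[R]_n this is the Borel
   sigma-algebra of R^n. *)
Definition matrix_measurable : set (set 'M[T]_(m, n)) :=
  <<s \bigcup_(ij in [set: 'I_m * 'I_n]) preimage_set_system setT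
        (fun A : 'M[T]_(m, n) => A ij.1 ij.2) measurable >>.

Let matrix_measurable0 : matrix_measurable set0.
Proof. exact: sigma_algebra0. Qed.

Let matrix_measurableC A : matrix_measurable A -> matrix_measurable (~` A).
Proof. exact: sigma_algebraC. Qed.

Let matrix_measurable_bigcup (F : (set 'M[T]_(m, n))^nat) :
  (forall i, matrix_measurable (F i)) -> matrix_measurable (\bigcup_i F i).
Proof. exact: sigma_algebra_bigcup. Qed.

HB.instance Definition _ := @isMeasurable.Build (measure_matrix_display d)
  'M[T]_(m, n) matrix_measurable
  matrix_measurable0 matrix_measurableC matrix_measurable_bigcup.

End measurable_matrix.

Lemma measurable_entry d (T : measurableType d) m n i j :
  measurable_fun setT (fun A : 'M[T]_(m, n) => A i j).
Proof.
move=> _ Y mY; apply: sub_sigma_algebra.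
by exists (i, j) => //; exists Y.
Qed.

Lemma measurable_fun_entries d d' (T : measurableType d)
    (T' : measurableType d') m n (f : T' -> 'M[T]_(m, n)) :
  (forall i j, measurable_fun setT (fun x => f x i j)) -> measurable_fun setT f.
Proof.
move=> mf.
apply: (measurability (\bigcup_(ij in [set: 'I_m * 'I_n]) preimage_set_system
  setT (fun A : 'M[T]_(m, n) => A ij.1 ij.2) measurable)) => //.
move=> _ [_ [[i j] _ [B mB <-]] <-].
by rewrite !setTI -comp_preimage -[X in measurable X]setTI; exact: mf.
Qed.

Section concatenation.
Context {R : realType}.

(* [x : z], with z in the last coordinate *)
Definition concat m (x : 'cV[R]_m) (z : R) : 'cV[R]_m.+1 :=
  \col_i oapp (fun j => x j 0) z (unlift ord_max i).

Lemma measurable_concat m :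
  measurable_fun setT (fun xz : 'cV[R]_m * R => concat xz.1 xz.2).
Proof.
apply: measurable_fun_entries => i j /=.
case: (unliftP ord_max i) => [k ->|->].
  rewrite (_ : (fun _ => _) = (fun A : 'cV[R]_m => A k 0) \o fst).
    by apply: measurableT_comp => //; exact: measurable_entry.
  by apply/funext => xz /=; rewrite mxE liftK.
rewrite (_ : (fun _ => _) = snd) //.
by apply/funext => xz /=; rewrite mxE unlift_none.
Qed.

Lemma row'_concat m (x : 'cV[R]_m) z : row' ord_max (concat x z) = x.
Proof. by apply/colP => i; rewrite !mxE liftK. Qed.

Lemma concat_max m (x : 'cV[R]_m) z : concat x z ord_max 0 = z.
Proof. by rewrite mxE unlift_none. Qed.

End concatenation.

Section lebesgue_cV.
Context {R : realType}.

Section step.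
Context m (mu : {sigma_finite_measure set 'cV[R]_m -> \bar R}).

Definition lebesgue_cV_step : set 'cV[R]_m.+1 -> \bar R :=
  pushforward (mu \x (@lebesgue_measure R))%E
    (fun xz : 'cV[R]_m * R => concat xz.1 xz.2).

Let preimage_concat (A : set 'cV[R]_m.+1) : measurable A ->
  measurable ((fun xz : 'cV[R]_m * R => concat xz.1 xz.2) @^-1` A).
Proof.
by move=> mA; rewrite -[X in measurable X]setTI; exact: measurable_concat.
Qed.

Let step0 : lebesgue_cV_step set0 = 0%E.
Proof. by rewrite /lebesgue_cV_step /pushforward preimage_set0 measure0. Qed.

Let step_ge0 A : (0 <= lebesgue_cV_step A)%E.
Proof. by rewrite /lebesgue_cV_step /pushforward measure_ge0. Qed.

Let step_sigma_additive : semi_sigma_additive lebesgue_cV_step.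
Proof.
move=> F mF tF mUF; rewrite /lebesgue_cV_step /pushforward preimage_bigcup.
apply: measure_semi_sigma_additive.
- by move=> n; exact: preimage_concat.
- apply/trivIsetP => /= i j _ _ ij; rewrite -preimage_setI.
  by move/trivIsetP : tF => /(_ _ _ _ _ ij) ->//; rewrite preimage_set0.
- by rewrite -preimage_bigcup; exact: preimage_concat.
Qed.

HB.instance Definition _ := isMeasure.Build _ _ _ lebesgue_cV_step
  step0 step_ge0 step_sigma_additive.

Let step_sigma_finite : sigma_finite setT lebesgue_cV_step.
Proof.
have /sigma_finiteP[F [FT ndF Foo]] := sigma_finiteT mu.
have /sigma_finiteP[G [GT ndG Goo]] := sigma_finiteT (@lebesgue_measure R).
exists (fun i => [set v | F i (row' ord_max v) /\ G i (v ord_max 0)]).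
  apply/esym; rewrite -subTset => v _.
  have : (\bigcup_i F i) (row' ord_max v) by rewrite -FT.
  have : (\bigcup_i G i) (v ord_max 0) by rewrite -GT.
  move=> [j _ Gj] [i _ Fi]; exists (maxn i j) => //=; split.
    by move/subsetPset : (ndF _ _ (leq_maxl i j)); apply.
  by move/subsetPset : (ndG _ _ (leq_maxr i j)); apply.
move=> i; have [mF Fi] := Foo i; have [mG Gi] := Goo i; split.
  apply: measurableI.
    rewrite -[X in measurable X]setTI.
    have : measurable_fun setT (fun v : 'cV[R]_m.+1 => row' ord_max v).
      apply: measurable_fun_entries => j k.
      rewrite (_ : (fun _ => _) = fun v : 'cV[R]_m.+1 => v (lift ord_max j) k).
        exact: measurable_entry.
      by apply/funext => v /=; rewrite mxE.
    exact.
  by rewrite -[X in measurable X]setTI; exact: measurable_entry.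
rewrite /lebesgue_cV_step /pushforward.
rewrite (_ : _ @^-1` _ = F i `*` G i); last first.
  by apply/seteqP; split => -[x z] /=; rewrite row'_concat concat_max.
by rewrite product_measure1E// lte_mul_pinfty// ge0_fin_numE.
Qed.

HB.instance Definition _ := Measure_isSigmaFinite.Build _ _ _ lebesgue_cV_step
  step_sigma_finite.

End step.

(* Lebesgue measure on R^n: the n-fold product of lebesgue_measure. *)
Fixpoint lebesgue_cV n : {sigma_finite_measure set 'cV[R]_n -> \bar R} :=
  match n with
  | 0%N => \d_(0 : 'cV[R]_0)
  | m.+1 => lebesgue_cV_step (lebesgue_cV m)
  end.

End lebesgue_cV.

Section geometry.
Context {R : realType}.

(* The library's norm on matrices is the sup norm, hence the explicit
   Euclidean inner product. *)
Definition dotp n (u v : 'cV[R]_n) : R := (u^T *m v) 0 0.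

Definition cball n : set 'cV[R]_n := [set x | dotp x x <= 1].
Arguments cball n : clear implicits.

Lemma cball0 n : (0 : 'cV[R]_n) \in cball n.
Proof. by rewrite inE /cball /= /dotp mulmx0 mxE ler01. Qed.

(* A point of R^n seen in the ball; only its values on cball n matter. *)
Definition to_cball n (v : 'cV[R]_n) : cball n :=
  insubd (exist _ 0 (cball0 n) : cball n) v.

Definition SO n : set 'M[R]_n := [set Q | Q *m Q^T = 1%:M /\ \det Q = 1].
Arguments SO n : clear implicits.

(* I_||x|| *)
Definition chord n (x : 'cV[R]_n) : set R :=
  `[- Num.sqrt (1 - dotp x x), Num.sqrt (1 - dotp x x)]%classic.

(* Q^T [x : z] *)
Definition ray m (Q : SO m.+1) (x : cball m) (z : R) : 'cV[R]_m.+1 :=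
  (val Q)^T *m concat (val x) z.

Definition last_axis m : 'cV[R]_m.+1 := delta_mx ord_max 0.

Definition eproj_adj m (Q : SO m.+1) (y : 'cV[R]_m) : 'cV[R]_m.+1 :=
  (val Q)^T *m concat y 0.

End geometry.
Arguments cball R n : clear implicits.
Arguments SO R n : clear implicits.

Section rkhs.
Context {R : realType}.

Definition reproducing_kernel (X : Type) (K : X -> X -> R) :=
  (forall u v, K u v = K v u) /\
  (forall (p : nat) (u : 'I_p -> X) (c : 'I_p -> R),
     0 <= \sum_i \sum_j c i * c j * K (u i) (u j)).

(* By the Moore-Aronszajn theorem a reproducing kernel K has exactly one such
   Hilbert space of functions. Outside rk_space, rk_dot is unconstrained. *)
Record rkhs (X : Type) (K : X -> X -> R) := Rkhs {
  rk_space : set (X -> R) ;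
  rk_dot : (X -> R) -> (X -> R) -> R ;
  rk_space0 : rk_space 0 ;
  rk_space_lin : forall a f g,
    rk_space f -> rk_space g -> rk_space (a *: f + g) ;
  rk_dotC : forall f g,
    rk_space f -> rk_space g -> rk_dot f g = rk_dot g f ;
  rk_dot_lin : forall a f g h, rk_space f -> rk_space g -> rk_space h ->
    rk_dot (a *: f + g) h = a * rk_dot f h + rk_dot g h ;
  rk_dot_ge0 : forall f, rk_space f -> 0 <= rk_dot f f ;
  rk_dot_eq0 : forall f, rk_space f -> rk_dot f f = 0 -> f = 0 ;
  rk_complete : forall f : nat -> X -> R, (forall i, rk_space (f i)) ->
    (forall e, 0 < e -> exists N : nat, forall i j, (N <= i)%N -> (N <= j)%N ->
       Num.sqrt (rk_dot (f i - f j) (f i - f j)) < e) ->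
    exists2 g, rk_space g &
      (fun i => Num.sqrt (rk_dot (f i - g) (f i - g))) @ \oo --> (0 : R) ;
  rk_kernel : forall v, rk_space (K^~ v) ;
  rk_reproducing : forall f v, rk_space f -> f v = rk_dot f (K^~ v) }.

Definition rk_norm (X : Type) (K : X -> X -> R) (H : rkhs K) (f : X -> R) : R :=
  Num.sqrt (rk_dot H f f).

Section operators.
Context (X X' : Type) (K : X -> X -> R) (K' : X' -> X' -> R).
Context (H : rkhs K) (H' : rkhs K').

Definition bounded_operator (T : (X -> R) -> (X' -> R)) :=
  [/\ forall f, rk_space H f -> rk_space H' (T f),
      forall a f g, rk_space H f -> rk_space H g ->
        T (a *: f + g) = a *: T f + T g
    & exists C, forall f, rk_space H f -> rk_norm H' (T f) <= C * rk_norm H f].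

Definition hilbert_adjoint (T : (X -> R) -> (X' -> R))
    (Tadj : (X' -> R) -> (X -> R)) :=
  (forall g, rk_space H' g -> rk_space H (Tadj g)) /\
  (forall f g, rk_space H f -> rk_space H' g ->
     rk_dot H' (T f) g = rk_dot H f (Tadj g)).

End operators.
End rkhs.

Section xray.
Context {R : realType} (m : nat).
Implicit Types (Q : SO R m.+1) (x : cball R m).

Definition xray (f : cball R m.+1 -> R) Q : cball R m -> R :=
  fun x => \int[@lebesgue_measure R]_(z in chord (val x)) f (to_cball (ray Q x z)).

Definition induced_kernel (K : cball R m.+1 -> cball R m.+1 -> R) Q :
    cball R m -> cball R m -> R :=
  fun x1 x2 =>
    \int[@lebesgue_measure R]_(z2 in chord (val x2))
      \int[@lebesgue_measure R]_(z1 in chord (val x1))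
        K (to_cball (ray Q x1 z1)) (to_cball (ray Q x2 z2)).

(* The integrals occurring in xray, induced_kernel and ball_moment exist. The
   inner integral of induced_kernel is the X-ray transform of K^~ v, which lies
   in the RKHS. *)
Definition integrals_exist (K : cball R m.+1 -> cball R m.+1 -> R)
    (H : rkhs K) :=
  [/\ forall f Q x, rk_space H f ->
        (@lebesgue_measure R).-integrable (chord (val x))
          (fun z => (f (to_cball (ray Q x z)))%:E),
      forall Q x1 x2, (@lebesgue_measure R).-integrable (chord (val x2))
          (fun z2 => (xray (K^~ (to_cball (ray Q x2 z2))) Q x1)%:E)
    & forall f, rk_space H f ->
        (@lebesgue_cV R m.+1).-integrable (cball R m.+1)
          (fun z => (f (to_cball z))%:E)].

Definition homogeneous_polynomial n (l : nat) (q : 'cV[R]_n -> R) :=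
  exists2 p : mpoly n R, p \is ishomog1 l mdeg &
    forall w, q w = meval (w^~ 0) p.

(* w |-> \int_(B^n) (z^T w)^l f(z) dz *)
Definition ball_moment (f : cball R m.+1 -> R) (l : nat) (w : 'cV[R]_m.+1) : R :=
  \int[@lebesgue_cV R m.+1]_(z in cball R m.+1)
    (dotp z w ^+ l * f (to_cball z)).

(* y |-> \int_(B^(n-1)) (x^T y)^l g(x) dx *)
Definition slice_moment (g : cball R m -> R) (l : nat) (y : 'cV[R]_m) : R :=
  \int[@lebesgue_cV R m]_(x in cball R m) (dotp x y ^+ l * g (to_cball x)).

Definition hl_compatibility (g : SO R m.+1 -> cball R m -> R) :=
  forall Q1 Q2 x1 x2,
    ((val Q1)^T *m last_axis m = (val Q2)^T *m last_axis m \/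
     (val Q1)^T *m last_axis m = - ((val Q2)^T *m last_axis m)) ->
    eproj_adj Q1 (val x1) = eproj_adj Q2 (val x2) -> g Q1 x1 = g Q2 x2.

Definition hl_moment (g : SO R m.+1 -> cball R m -> R) :=
  forall l : nat, exists2 q : 'cV[R]_m.+1 -> R, homogeneous_polynomial l q &
    forall Q y, slice_moment (g Q) l y = q (eproj_adj Q y).

Definition helgason_ludwig (g : SO R m.+1 -> cball R m -> R) :=
  hl_compatibility g /\ hl_moment g.

End xray.

Section tikhonov.
Context {R : realType} (X : Type) (K : X -> X -> R) (H : rkhs K) (N M : nat).
Context (h : 'I_N -> 'I_M -> X -> R) (y : 'I_N -> 'I_M -> R) (nu : R).

(* W and Y, with the pairs (i, j) enumerated by mxvec *)
Definition tikhonov_gram : 'M[R]_(N * M) :=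
  let hvec := mxvec (\matrix_(i, j) h i j) in
  \matrix_(a, b) rk_dot H (hvec 0 a) (hvec 0 b).

Definition tikhonov_coef : 'M[R]_(N, M) :=
  vec_mx (invmx (tikhonov_gram + nu%:M) *m (mxvec (\matrix_(i, j) y i j))^T)^T.

Definition tikhonov_solution : X -> R :=
  \sum_i \sum_j tikhonov_coef i j *: h i j.

(* The data-fit term for measurements f |-> <f, h i j>; with h i j the element
   P_(R_i)^* k~_(x_j), the measurement is P_(R_i) f (x_j). *)
Definition tikhonov_functional (f : X -> R) : R :=
  \sum_i \sum_j (y i j - rk_dot H f (h i j)) ^+ 2 + nu * rk_norm H f ^+ 2.

Hypotheses (nu_gt0 : 0 < nu) (hH : forall i j, rk_space H (h i j)).

Let hv (a : 'I_(N * M)) : X -> R := mxvec (\matrix_(i, j) h i j) 0 a.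
Let yv (a : 'I_(N * M)) : R := mxvec (\matrix_(i, j) y i j) 0 a.
Let al : 'cV[R]_(N * M) :=
  invmx (tikhonov_gram + nu%:M) *m (mxvec (\matrix_(i, j) y i j))^T.

Let reidx (V : nmodType) (F : 'I_(N * M) -> V) :
  \sum_a F a = \sum_i \sum_j F (mxvec_index i j).
Proof.
rewrite pair_big_dep /=; rewrite (reindex _ (curry_mxvec_bij N M)) /=.
by apply: eq_bigr => -[].
Qed.

Let hvH a : rk_space H (hv a).
Proof. by case/mxvec_indexP: a => i j; rewrite /hv mxvecE mxE. Qed.

Let solE : tikhonov_solution = \sum_a al a 0 *: hv a.
Proof.
rewrite reidx; apply: eq_bigr => i _; apply: eq_bigr => j _.
by rewrite /hv mxvecE mxE /tikhonov_coef mxE mxE.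
Qed.

Let spZ a f : rk_space H f -> rk_space H (a *: f).
Proof. by move=> /(rk_space_lin a) /(_ (rk_space0 H)); rewrite addr0. Qed.

Let spD f g : rk_space H f -> rk_space H g -> rk_space H (f + g).
Proof. by move=> /(rk_space_lin 1) fD /fD; rewrite scale1r. Qed.

Let dotDl f g k : rk_space H f -> rk_space H g -> rk_space H k ->
  rk_dot H (f + g) k = rk_dot H f k + rk_dot H g k.
Proof.
by move=> Hf Hg Hk; rewrite -[f]scale1r rk_dot_lin// mul1r scale1r.
Qed.

Let dot0l k : rk_space H k -> rk_dot H 0 k = 0.
Proof.
move=> Hk; have H0 := rk_space0 H.
by apply: (addrI (rk_dot H 0 k)); rewrite -dotDl// !addr0.
Qed.

Let dotZl a f k : rk_space H f -> rk_space H k ->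
  rk_dot H (a *: f) k = a * rk_dot H f k.
Proof.
move=> Hf Hk; have H0 := rk_space0 H.
by rewrite -[a *: f]addr0 rk_dot_lin// dot0l// addr0.
Qed.

Let sp_sum (c : 'I_(N * M) -> R) (s : seq 'I_(N * M)) :
  rk_space H (\sum_(a <- s) c a *: hv a).
Proof.
elim: s => [|a s IH]; first by rewrite big_nil; exact: rk_space0.
by rewrite big_cons; exact: rk_space_lin.
Qed.

Let dot_suml (c : 'I_(N * M) -> R) k : rk_space H k ->
  rk_dot H (\sum_a c a *: hv a) k = \sum_a c a * rk_dot H (hv a) k.
Proof.
move=> Hk; elim: (index_enum _) => [|a s IH].
  by rewrite !big_nil dot0l.
by rewrite !big_cons rk_dot_lin// IH.
Qed.

Lemma tikhonov_solution_space : rk_space H tikhonov_solution.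
Proof. by rewrite solE. Qed.

Lemma tikhonov_gram_unit : tikhonov_gram + nu%:M \in unitmx.
Proof.
rewrite -unitmx_tr -row_free_unit -kermx_eq0; apply/rowV0P => u /sub_kermxP.
rewrite linearD /= tr_scalar_mx mulmxDr mul_mx_scalar => u0.
have : \sum_a u 0 a * ((u *m tikhonov_gram^T + nu *: u) 0 a) = 0.
  by rewrite u0; apply: big1 => a _; rewrite mxE mulr0.
under eq_bigr do rewrite !mxE mulrDr.
rewrite big_split /=.
have -> : \sum_a u 0 a * (\sum_j u 0 j * tikhonov_gram^T j a) =
    rk_dot H (\sum_a u 0 a *: hv a) (\sum_a u 0 a *: hv a).
  rewrite dot_suml//; apply: eq_bigr => a _; congr *%R.
  rewrite rk_dotC// dot_suml//; apply: eq_bigr => b _; congr *%R.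
  by rewrite !mxE rk_dotC.
have := rk_dot_ge0 (sp_sum (u 0) (index_enum _)).
set d := rk_dot _ _ _ => d0 /eqP.
have sq0 a : 0 <= u 0 a * (nu * u 0 a).
  by rewrite mulrCA mulr_ge0 ?(ltW nu_gt0)// -expr2 sqr_ge0.
rewrite paddr_eq0 ?sumr_ge0// => /andP[_].
rewrite psumr_eq0// => /allP ua; apply/rowP => a; rewrite mxE.
have /ua /implyP/(_ isT) : a \in index_enum 'I_(N * M) by rewrite mem_index_enum.
by rewrite mulrCA mulf_eq0 (gt_eqF nu_gt0) /= mulf_eq0 orbb => /eqP.
Qed.

Let residual a : yv a - rk_dot H tikhonov_solution (hv a) = nu * al a 0.
Proof.
have : (tikhonov_gram + nu%:M) *m al = (mxvec (\matrix_(i, j) y i j))^T.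
  by rewrite /al mulKVmx// tikhonov_gram_unit.
rewrite mulmxDl mul_scalar_mx => /colP /(_ a); rewrite !mxE => yE.
apply/eqP; rewrite subr_eq addrC solE dot_suml// eq_sym /yv -yE; apply/eqP.
congr +%R; apply: eq_bigr => b _; rewrite mulrC; congr *%R.
by rewrite mxE rk_dotC.
Qed.

Lemma tikhonov_functionalD g : rk_space H g ->
  tikhonov_functional (tikhonov_solution + g) =
  tikhonov_functional tikhonov_solution +
  (\sum_i \sum_j rk_dot H g (h i j) ^+ 2 + nu * rk_dot H g g).
Proof.
move=> Hg; have Hs := tikhonov_solution_space.
have JE f : rk_space H f -> tikhonov_functional f =
    \sum_a (yv a - rk_dot H f (hv a)) ^+ 2 + nu * rk_dot H f f.
  move=> Hf; rewrite /tikhonov_functional /rk_norm sqr_sqrtr ?rk_dot_ge0//.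
  rewrite reidx; congr +%R; apply: eq_bigr => i _; apply: eq_bigr => j _.
  by rewrite /hv /yv !mxvecE !mxE.
have -> : \sum_i \sum_j rk_dot H g (h i j) ^+ 2 =
    \sum_a rk_dot H g (hv a) ^+ 2.
  rewrite reidx; apply: eq_bigr => i _; apply: eq_bigr => j _.
  by rewrite /hv mxvecE mxE.
rewrite !JE//; last exact: spD.
rewrite dotDl//; last exact: spD.
rewrite [rk_dot H _ (_ + g)]rk_dotC//; last exact: spD.
rewrite [rk_dot H g (_ + g)]rk_dotC//; last exact: spD.
rewrite !dotDl// [rk_dot H g tikhonov_solution]rk_dotC//.
have -> : \sum_a (yv a - rk_dot H (tikhonov_solution + g) (hv a)) ^+ 2 =
    \sum_a (yv a - rk_dot H tikhonov_solution (hv a)) ^+ 2 +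
    \sum_a rk_dot H g (hv a) ^+ 2 -
    2 * nu * rk_dot H tikhonov_solution g.
  rewrite [in X in _ - X]solE dot_suml// mulr_sumr -sumrN -!big_split /=.
  apply: eq_bigr => a _; rewrite dotDl//.
  rewrite opprD addrA residual [rk_dot H g _]rk_dotC//.
  by ring.
by ring.
Qed.

(* tikhonov_solution is the unique minimizer of tikhonov_functional. *)
Lemma tikhonov_solution_min f : rk_space H f ->
  tikhonov_functional tikhonov_solution <= tikhonov_functional f /\
  (tikhonov_functional f <= tikhonov_functional tikhonov_solution ->
   f = tikhonov_solution).
Proof.
move=> Hf; have Hs := tikhonov_solution_space.
have Hg : rk_space H (f - tikhonov_solution).
  by rewrite addrC -scaleN1r; exact: rk_space_lin.
have -> : f = tikhonov_solution + (f - tikhonov_solution) by rewrite addrC subrK.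
rewrite tikhonov_functionalD//; set g := f - _.
have S0 : 0 <= \sum_i \sum_j rk_dot H g (h i j) ^+ 2.
  by apply: sumr_ge0 => i _; apply: sumr_ge0 => j _; exact: sqr_ge0.
have g0 : 0 <= nu * rk_dot H g g by rewrite mulr_ge0 ?(ltW nu_gt0) ?rk_dot_ge0.
split; first by rewrite lerDl addr_ge0.
rewrite gerDl => le0; rewrite [g](@rk_dot_eq0 _ _ _ H) ?addr0//.
have : nu * rk_dot H g g <= 0 by apply: le_trans le0; rewrite lerDr.
by rewrite pmulr_rle0// => dle0; apply/eqP; rewrite eq_le dle0 rk_dot_ge0.
Qed.

End tikhonov.

(* Main.v *)
From HB Require Import structures.
Require Import Defs.
From mathcomp Require Import all_boot all_order all_algebra.
From mathcomp Require Import -(notations) mpoly.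
From mathcomp Require Import all_classical all_reals all_analysis.
From mathcomp Require Import measurable_realfun.
Import Order.TTheory GRing.Theory Num.Theory.
Set Implicit Arguments.
Unset Strict Implicit.
Unset Printing Implicit Defensive.
Local Open Scope classical_set_scope.
Local Open Scope ring_scope.

(** Evaluation of an X-ray image at a point is, by the reproducing property of
    the induced kernel and the definition of the adjoint, the inner product
    with the representer [rep Q x]; expanding the Tikhonov solution in its
    second argument gives the interpolation formula ([rk_dot_tikhonov]).

    The consistency conditions hold for the X-ray transform of any function
    that is integrable on the ball and along every chord, hence for that of
    every element of the space [H].

    - Compatibility ([hl_compatibility_xray]): the point at parameter [z] of a
      ray is the foot of the ray plus [z] times its direction [Q^T e_n].  Two
      rays with the same foot and opposite directions are therefore the same
      chord run backwards, and Lebesgue measure on the line is invariant under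
      negation.

    - Moments ([slice_moment_xray]): for [w = concat x z] the inner product of
      [x] and [v] is that of [w] and [concat v 0].  Fubini's
      theorem ([Rintegral_cball_fubini]) turns the moment of the X-ray image
      into the integral over the n-ball of
      [dotp w (concat v 0) ^+ l * f (Q^T w)].  The substitution [w = Q u] turns
      this into the moment of [f] in the direction [Q^T (concat v 0)], provided
      Lebesgue measure is rotation invariant.  That the moment is a homogeneous
      polynomial is seen by expanding the power of the inner product into
      monomials ([expr_dotp], [homogeneous_ball_moment]).

    The rotation invariance of the iterated product [lebesgue_cV]
    ([lebesgue_cV_orthogonal]) is derived from its translation invariance.  Two
    translation invariant measures on R^n are proportional
    ([shift_invariant_proportional]); the image of Lebesgue measure under an
    orthogonal matrix is translation invariant, and it gives the unit ball the
    same volume because the ball is preserved; as this volume is positive and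
    finite, the factor is 1. *)

(** * Measurability of the linear structure of R^n *)

Section Measurability.
Context {R : realType}.

Lemma measurable_preimage d d' (T : measurableType d) (T' : measurableType d')
    (f : T -> T') (A : set T') :
  measurable_fun setT f -> measurable A -> measurable (f @^-1` A).
Proof. by move=> mf mA; rewrite -[X in measurable X]setTI; exact: mf. Qed.

Lemma measurable_addcV n :
  measurable_fun setT (fun p : 'cV[R]_n * 'cV[R]_n => p.1 + p.2).
Proof.
apply: measurable_fun_entries => i j.
under eq_fun do rewrite mxE.
apply: measurable_funD.
- exact: (measurableT_comp (measurable_entry i j) measurable_fst).
- exact: (measurableT_comp (measurable_entry i j) measurable_snd).
Qed.

Lemma measurable_oppcV n : measurable_fun setT (fun v : 'cV[R]_n => - v).
Proof.
apply: measurable_fun_entries => i j.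
under eq_fun do rewrite mxE.
by apply: measurableT_comp => //; exact: measurable_entry.
Qed.

Lemma measurable_addcVr n (t : 'cV[R]_n) :
  measurable_fun setT (fun v : 'cV[R]_n => v + t).
Proof. exact: (measurable_fun_pair1 t (@measurable_addcV n)). Qed.

Lemma measurable_mulmxcV m n (Q : 'M[R]_(m, n)) :
  measurable_fun setT (fun v : 'cV[R]_n => Q *m v).
Proof.
apply: measurable_fun_entries => i j.
under eq_fun do rewrite mxE.
apply: measurable_sum => k; apply: measurable_funM => //.
exact: measurable_entry.
Qed.

Lemma dotpE n (u v : 'cV[R]_n) : dotp u v = \sum_i u i 0 * v i 0.
Proof. by rewrite /dotp mxE; apply: eq_bigr => i _; rewrite mxE. Qed.

Lemma measurable_cball n : measurable (cball R n).
Proof.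
have mf : measurable_fun setT (fun v : 'cV[R]_n => dotp v v).
  under eq_fun do rewrite dotpE.
  apply: measurable_sum => k.
  by apply: measurable_funM; exact: measurable_entry.
rewrite (_ : cball R n = setT `&` (fun v => dotp v v) @^-1` `]-oo, 1]).
  exact: mf.
by rewrite setTI; apply/seteqP; split => v; rewrite /cball /= in_itv.
Qed.

(** The volume of a cube is immediate from the iterated product; comparison with
    cubes shows that the volume of the ball is positive and finite. *)
Definition cube n (a : R) : set 'cV[R]_n := [set v | forall i, `|v i 0| <= a].
Arguments cube n a : clear implicits.

Lemma measurable_cube n a : measurable (cube n a).
Proof.
rewrite (_ : cube n a = \bigcap_(i : 'I_n) ((fun v => v i 0) @^-1` `[-a, a])).
  apply: fin_bigcap_measurable => // i _.
  apply: measurable_preimage => //; exact: measurable_entry.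
apply/seteqP; split => v /= h i; have := h i.
  by move=> hi _; rewrite /= in_itv /= -ler_norml.
by move=> /(_ I); rewrite /= in_itv /= -ler_norml.
Qed.

End Measurability.
Arguments cube {R} n a.

(** * Measure preserving maps *)

Section MeasurePreserving.
Local Open Scope ereal_scope.
Context d (T : measurableType d) (R : realType).
Context (mu : {measure set T -> \bar R}) (phi : T -> T).
Hypothesis mphi : measurable_fun setT phi.
Hypothesis muphi : forall C, measurable C -> mu (phi @^-1` C) = mu C.

Let ge0_integral_preserved (f : T -> \bar R) :
  measurable_fun setT f -> (forall x, 0 <= f x) ->
  \int[mu]_x f (phi x) = \int[mu]_x f x.
Proof.
move=> mf f0.
have := @ge0_integral_pushforward _ _ _ _ _ _ mphi mu setT f measurableT mf
  (fun x _ => f0 x).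
rewrite /comp preimage_setT => <-.
by apply: eq_measure_integral => // B mB _; exact: muphi.
Qed.

(** The integral is the difference of those of the positive and negative parts,
    and each of them is preserved. *)
Lemma integral_preserved (f : T -> \bar R) :
  measurable_fun setT f -> \int[mu]_x f (phi x) = \int[mu]_x f x.
Proof.
move=> mf; rewrite integralE [RHS]integralE; congr (_ - _).
- rewrite -[RHS]ge0_integral_preserved//; first by apply: eq_integral => x _;
    rewrite -[X in (X^\+ x)]/(f \o phi) funepos_comp.
  exact: measurable_funepos.
- rewrite -[RHS]ge0_integral_preserved//; first by apply: eq_integral => x _;
    rewrite -[X in (X^\- x)]/(f \o phi) funeneg_comp.
  exact: measurable_funeneg.
Qed.

Lemma integrable_preserved (f : T -> \bar R) :
  mu.-integrable setT f -> mu.-integrable setT (f \o phi).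
Proof.
move=> /integrableP[mf foo]; apply/integrableP; split.
  exact: measurableT_comp.
by rewrite [X in X < _](integral_preserved (f := abse \o f))//;
  exact: measurableT_comp.
Qed.

End MeasurePreserving.

(** * Orthogonal matrices and the unit ball *)

Section Ball.
Context {R : realType}.

Lemma dotp_mulmx m n (Q : 'M[R]_(m, n)) u v :
  dotp (Q *m u) v = dotp u (Q^T *m v).
Proof. by rewrite /dotp trmx_mul mulmxA. Qed.

Lemma dotp_concat n (x y : 'cV[R]_n) z w :
  dotp (concat x z) (concat y w) = dotp x y + z * w.
Proof.
rewrite !dotpE (bigD1_ord ord_max)//= !concat_max addrC; congr +%R.
by apply: eq_bigr => i _; rewrite !mxE liftK.
Qed.

Lemma cball_entry n (v : 'cV[R]_n) i : cball R n v -> `|v i 0| <= 1.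
Proof.
rewrite /cball /= dotpE => v1.
rewrite -(@ler_pXn2r _ 2)// ?nnegrE// expr1n real_normK ?num_real//.
apply: le_trans v1; rewrite (bigD1 i)//= expr2 lerDl.
by apply: sumr_ge0 => j _; rewrite -expr2 sqr_ge0.
Qed.

Lemma orthogonal_dotp n (Q : 'M[R]_n) u v : Q *m Q^T = 1%:M ->
  dotp (Q *m u) (Q *m v) = dotp u v.
Proof. by move=> QQT; rewrite dotp_mulmx mulmxA (mulmx1C QQT) mul1mx. Qed.

Lemma mem_cball_orthogonal n (Q : 'M[R]_n) z : Q *m Q^T = 1%:M ->
  (Q *m z \in cball R n) = (z \in cball R n).
Proof.
by move=> QQT; apply/idP/idP; rewrite !inE /cball /= orthogonal_dotp.
Qed.

(** The ball is fibred over its equatorial ball with the chords as fibres; this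
    is where [chord] gets its half-length [sqrt (1 - |x|^2)]. *)
Lemma cball_concat m (x : 'cV[R]_m) z : cball R m.+1 (concat x z) <->
  cball R m x /\ chord x z.
Proof.
rewrite /cball /chord /= dotp_concat in_itv /= -ler_norml; split.
  move=> xz; have x1 : dotp x x <= 1.
    by apply: le_trans xz; rewrite lerDl -expr2 sqr_ge0.
  split=> //; rewrite -(@ler_pXn2r _ 2)// ?nnegrE ?sqrtr_ge0//.
  by rewrite sqr_sqrtr ?subr_ge0// real_normK ?num_real// lerBrDl expr2.
move=> [x1]; rewrite -(@ler_pXn2r _ 2)// ?nnegrE ?sqrtr_ge0//.
by rewrite sqr_sqrtr ?subr_ge0// real_normK ?num_real// lerBrDl expr2.
Qed.

End Ball.

(** * Translation invariance of Lebesgue measure *)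

Section LebesguePower.
Context {R : realType}.
Local Notation L n := (@lebesgue_cV R n).

Lemma lebesgue_measure_shift (t : R) (A : set R) : measurable A ->
  lebesgue_measure ((fun z => z + t) @^-1` A) = lebesgue_measure A.
Proof.
move=> mA.
pose shift (z : measurableTypeR R) : measurableTypeR R := z + t.
have mshift : measurable_fun setT shift by exact: measurable_funD.
apply/esym.
apply: (@lebesgue_measure_unique R (pushforward lebesgue_measure shift)) =>
  //= _ [[a b]] _ <-.
rewrite /pushforward (_ : _ @^-1` _ = `]a - t, b - t]%classic).
  rewrite !lebesgue_measure_itv/= !lte_fin ltrD2r -!EFinB.
  by rewrite opprB addrA subrK.
by apply/seteqP; split => z /=; rewrite !in_itv /= ltrBlDr lerBrDr.
Qed.

Lemma concatD n (x y : 'cV[R]_n) z w :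
  concat x z + concat y w = concat (x + y) (z + w).
Proof.
apply/colP => i; rewrite !mxE.
by case: (unlift ord_max i) => [j|] //=; rewrite mxE.
Qed.

Lemma concat_row' n (v : 'cV[R]_n.+1) :
  concat (row' ord_max v) (v ord_max 0) = v.
Proof.
by apply/colP => i; rewrite mxE; case: unliftP => [j ->|->] //=; rewrite mxE.
Qed.

(** The volume of a set is the integral of the lengths of its sections, which
    is the induction step of every computation with the iterated product. *)
Lemma lebesgue_cVS n (A : set 'cV[R]_n.+1) : L n.+1 A =
  (\int[L n]_x lebesgue_measure [set z | A (concat x z)])%E.
Proof.
rewrite /= /lebesgue_cV_step /pushforward /product_measure1.
apply: eq_integral => x _ /=; congr (lebesgue_measure _).
by apply/seteqP; split => z; rewrite /xsection /= inE.
Qed.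

Definition shift_invariant n (mu : set 'cV[R]_n -> \bar R) :=
  forall (t : 'cV[R]_n) (A : set 'cV[R]_n), measurable A ->
    mu ((fun v => v + t) @^-1` A) = mu A.

(** A translation by [t] splits into a translation inside each section, by the
    last entry of [t], and a translation of the base by the other entries. *)
Lemma lebesgue_cV_shift n : shift_invariant (L n).
Proof.
elim: n => [|n IH] t A mA.
  rewrite (_ : _ @^-1` A = A)//.
  by apply/seteqP; split=> v /=; rewrite (_ : v + t = v)//; apply/colP => -[].
rewrite !lebesgue_cVS.
have mS x : measurable [set z | A (concat x z)].
  have := measurable_preimage (@measurable_concat R n) mA.
  move/(measurable_xsection x); rewrite /xsection /=.
  by under eq_set do rewrite inE.
pose t' : 'cV[R]_n := row' ord_max t.
transitivity
  (\int[L n]_x lebesgue_measure [set z | A (concat (x + t')%R z)])%E.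
  apply: eq_integral => x _ /=.
  rewrite -[RHS](lebesgue_measure_shift (t ord_max 0))//.
  have xzt z : concat x z + t = concat (x + t') (z + t ord_max 0).
    by rewrite -{1}[t]concat_row' concatD.
  by congr (lebesgue_measure _); apply/seteqP; split => z /=; rewrite xzt.
have mphi : measurable_fun setT (fun x' : 'cV[R]_n =>
    lebesgue_measure [set z | A (concat x' z)]).
  have := measurable_fun_xsection (@lebesgue_measure R)
    (measurable_preimage (@measurable_concat R n) mA).
  apply: eq_measurable_fun => x _ /=; congr (lebesgue_measure _).
  by apply/seteqP; split => z; rewrite /xsection /= inE.
exact: (integral_preserved (measurable_addcVr t') (IH t') mphi).
Qed.

(** * Proportionality of translation invariant measures *)

(** Uniqueness of Haar measure, by Tonelli's theorem alone: the double integral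
    of [1_B x * 1_A (x + y)] is [mu B * nu A] by the invariance of [nu].
    Integrating first in [x] and replacing [x] by [x - y] makes it the double
    integral of [1_B (x - y) * 1_A x], whose inner integral in [y] is
    [nu (x - B)], that is [nu B] because [B] is symmetric. *)
Lemma shift_invariant_proportional n
    (mu nu : {sigma_finite_measure set 'cV[R]_n -> \bar R})
    (B : set 'cV[R]_n) :
  shift_invariant mu -> shift_invariant nu ->
  measurable B -> -%R @^-1` B = B ->
  forall A, measurable A -> (mu B * nu A = nu B * mu A)%E.
Proof.
move=> muT nuT mB symB A mA.
have mD : measurable_fun setT (fun p : 'cV[R]_n * 'cV[R]_n => (p.1 + p.2)%R).
  exact: measurable_addcV.
have mB' : measurable_fun setT (fun p : 'cV[R]_n * 'cV[R]_n => (p.1 - p.2)%R).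
  apply: (measurableT_comp (measurable_addcV (n := n))
    (g := fun p : 'cV[R]_n * 'cV[R]_n => (p.1, - p.2))).
  apply/measurable_fun_pair => //.
  exact: (measurableT_comp (@measurable_oppcV R n) measurable_snd).
have mI d (T : measurableType d) (C : set T) : measurable C ->
  measurable_fun setT (fun x => (\1_C x)%:E : \bar R).
  by move=> mC; exact/measurable_EFinP/measurable_indic.
have mIc d d' (T : measurableType d) (T' : measurableType d') (C : set T)
    (g : T' -> T) :
  measurable C -> measurable_fun setT g ->
  measurable_fun setT (fun x => (\1_C (g x))%:E : \bar R).
  by move=> mC mg; exact: (measurableT_comp (mI _ _ _ mC) mg).
have I0 T (C : set T) x : (0 <= (\1_C x)%:E :> \bar R)%E by rewrite lee_fin.
have intS (la : {measure set 'cV[R]_n -> \bar R}) (C : set 'cV[R]_n)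
    (t : 'cV[R]_n) : measurable C -> shift_invariant la ->
  (\int[la]_x (\1_C (x + t)%R)%:E = la C)%E.
  move=> mC laT.
  have := integral_indic la measurableT
    (measurable_preimage (measurable_addcVr t) mC).
  by rewrite setIT laT.
transitivity (\int[mu]_x \int[nu]_y ((\1_B x)%:E * (\1_A (x + y)%R)%:E))%E.
  under eq_integral.
    move=> x _; rewrite ge0_integralZl//; last first.
      by apply: mIc => //; exact: (measurable_fun_pair2 _ mD).
    under eq_integral do rewrite addrC.
    rewrite intS//; over.
  rewrite ge0_integralZr//=; last exact: mI.
  by rewrite integral_indic// setIT.
rewrite (fubini_tonelli (fun p : 'cV[R]_n * 'cV[R]_n =>
  ((\1_B p.1)%:E * (\1_A (p.1 + p.2)%R)%:E)%E))//=; last first.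
  apply: emeasurable_funM; last exact: mIc.
  by apply: mIc => //; exact: measurable_fst.
transitivity (\int[nu]_y \int[mu]_x ((\1_B (x - y)%R)%:E * (\1_A x)%:E))%E.
  apply: eq_integral => y _.
  rewrite -[RHS](integral_preserved (measurable_addcVr y) (muT y))/=.
    by apply: eq_integral => x _ /=; rewrite addrK.
  apply: emeasurable_funM; last exact: mI.
  by apply: mIc => //; exact: (measurable_fun_pair1 _ mB').
rewrite -(fubini_tonelli (fun p : 'cV[R]_n * 'cV[R]_n =>
  ((\1_B (p.1 - p.2)%R)%:E * (\1_A p.1)%:E)%E))//=; last first.
  apply: emeasurable_funM; first exact: mIc.
  by apply: mIc => //; exact: measurable_fst.
transitivity (\int[mu]_x (nu B * (\1_A x)%:E))%E; last first.
  by rewrite ge0_integralZl//; [rewrite integral_indic// setIT|exact: mI].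
apply: eq_integral => x _.
rewrite ge0_integralZr//; last first.
  by apply: mIc => //; exact: (measurable_fun_pair2 _ mB').
congr (_ * _)%E.
rewrite -(intS nu B (- x) mB nuT); apply: eq_integral => y _; congr (_%:E).
by rewrite -[in LHS]symB -[y - x]opprB.
Qed.

(** * Volume of the unit ball *)

Lemma lebesgue_cube n (a : R) : 0 <= a -> L n (cube n a) = ((a *+ 2) ^+ n)%:E.
Proof.
move=> a0; elim: n => [|n IH].
  by rewrite /= diracE mem_set//; case.
rewrite lebesgue_cVS.
(* Each section is an interval of length 2a, or empty off the base cube. *)
transitivity (\int[L n]_x (((a *+ 2)%:E * (\1_(cube n a) x)%:E)))%E.
  apply: eq_integral => x _; have [xa|xa] := pselect (cube n a x).
    rewrite indicE mem_set// mule1.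
    rewrite (_ : [set z | _] = `[-a, a]%classic).
      rewrite lebesgue_measure_itv /= lte_fin.
      have [->|a_neq0] := eqVneq a 0; first by rewrite oppr0 ltxx mul0rn.
      by rewrite gtrN ?lt_def ?a_neq0// -EFinB opprK -mulr2n.
    apply/seteqP; split => z /=.
      by move/(_ ord_max); rewrite concat_max in_itv /= ler_norml.
    rewrite in_itv /= -ler_norml => za i.
    by rewrite mxE; case: unliftP => [j _|_] //=; exact: xa.
  rewrite indicE memNset// mule0 (_ : [set z | _] = set0) ?measure0//.
  rewrite -subset0 => z /= h; apply: xa => i.
  by have := h (lift ord_max i); rewrite mxE liftK.
rewrite ge0_integralZl//; last 2 first.
- by apply/measurable_EFinP/measurable_indic; exact: measurable_cube.
- by rewrite lee_fin mulrn_wge0.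
have mcube : measurable (cube n a) by exact: measurable_cube.
by rewrite integral_indic// setIT [X in (_ * X)%E]IH -EFinM -exprS.
Qed.

Lemma lebesgue_cball_lty n : (L n (cball R n) < +oo)%E.
Proof.
apply: (@le_lt_trans _ _ (L n (cube n 1))); last by rewrite lebesgue_cube ?ltry.
apply: le_measure.
- by rewrite inE; exact: measurable_cball.
- by rewrite inE; exact: measurable_cube.
by move=> v vB i; exact: cball_entry.
Qed.

(** The cube of half-side [1 / (n + 1)] lies in the ball, as [n] squares of
    numbers at most [1 / (n + 1)] add up to at most 1.  The shift by one keeps
    the half-side positive in dimension 0. *)
Lemma lebesgue_cball_gt0 n : (0 < L n (cball R n))%E.
Proof.
have n0 : 0 < (n.+1%:R : R)^-1 by rewrite invr_gt0.
apply: (@lt_le_trans _ _ (L n (cube n n.+1%:R^-1))).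
  by rewrite lebesgue_cube ?ltW// lte_fin exprn_gt0// mulrn_wgt0.
apply: le_measure.
- by rewrite inE; exact: measurable_cube.
- by rewrite inE; exact: measurable_cball.
move=> v va; rewrite /cball /= dotpE.
apply: (@le_trans _ _ (\sum_(i < n) n.+1%:R^-1)).
  apply: ler_sum => i _; rewrite -expr2 -[_ ^+ 2]real_normK ?num_real//.
  rewrite -[leRHS]mulr1; apply: ler_pM => //.
  by apply: le_trans (va i) _; rewrite invf_le1// ler1n.
rewrite sumr_const card_ord -[_ *+ n]mulr_natl ler_pdivrMr// mul1r ler_nat.
exact: leqnSn.
Qed.

(** * Rotation invariance of Lebesgue measure *)

(** The image of Lebesgue measure under [Q] is translation invariant, a
    translation by [t] being carried to one by [Q^T t], hence proportional to
    Lebesgue measure; the ball is its own preimage and has a positive finite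
    volume, which fixes the factor. *)
Lemma lebesgue_cV_orthogonal n (Q : 'M[R]_n) A :
  Q *m Q^T = 1%:M -> measurable A ->
  L n ((fun v => Q *m v) @^-1` A) = L n A.
Proof.
move=> QQT mA.
have mQ := measurable_mulmxcV Q; have mQT := measurable_mulmxcV Q^T.
have QTQ := mulmx1C QQT.
pose push : {measure set 'cV[R]_n -> \bar R} :=
  pushforward (L n) (fun v => Q *m v).
pose nu0 := push mQ.
(* An exhaustion for the image measure is carried over by the inverse of Q. *)
have sf : sigma_finite setT nu0.
  have /sigma_finiteP[F [FT ndF Foo]] := sigma_finiteT (L n).
  exists (fun i => (fun v => Q^T *m v) @^-1` F i).
    by rewrite -preimage_bigcup -FT preimage_setT.
  move=> i; have [mF Fi] := Foo i; split; first exact: measurable_preimage.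
  rewrite /nu0 /= /pushforward (_ : _ @^-1` _ = F i)//.
  by apply/seteqP; split => v /=; rewrite mulmxA QTQ mul1mx.
pose spush : {sigma_finite_measure set 'cV[R]_n -> \bar R} :=
  HB.pack (pushforward (L n) (fun v => Q *m v)) (Measure.class nu0)
    (Measure_isSigmaFinite.Build _ _ _ nu0 sf).
pose nu := spush mQ.
have nuE (C : set 'cV[R]_n) : nu C = L n ((fun v => Q *m v) @^-1` C) by [].
have nuT : shift_invariant nu.
  move=> t C mC; rewrite !nuE.
  rewrite -[RHS](lebesgue_cV_shift (Q^T *m t)); last exact: measurable_preimage.
  congr (L n _); apply/seteqP; split => v /=;
    by rewrite mulmxDr mulmxA QQT mul1mx.
have symB : -%R @^-1` cball R n = cball R n.
  have dotpNN (v : 'cV[R]_n) : dotp (- v) (- v) = dotp v v.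
    by rewrite !dotpE; apply: eq_bigr => i _; rewrite !mxE mulrNN.
  by apply/seteqP; split => v; rewrite /cball /= dotpNN.
have := shift_invariant_proportional (@lebesgue_cV_shift n) nuT
  (@measurable_cball R n) symB mA.
rewrite !nuE (_ : _ @^-1` cball R n = cball R n); last first.
  by apply/seteqP; split => v; rewrite /cball /= orthogonal_dotp.
have B0 := lebesgue_cball_gt0 n; have Boo := lebesgue_cball_lty n.
have Bfin : L n (cball R n) \is a fin_num by rewrite ge0_fin_numE.
by move=> BA; apply/eqP; rewrite eq_le; apply/andP; split;
  rewrite -(lee_pmul2l Bfin B0) BA.
Qed.

End LebesguePower.

(** * Integration over the ball *)

Section BallIntegrals.
Context {R : realType}.
Local Notation L n := (@lebesgue_cV R n).

Lemma Rintegral_cball_orthogonal n (Q : 'M[R]_n) (g : 'cV[R]_n -> R) :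
  Q *m Q^T = 1%:M -> measurable_fun (cball R n) g ->
  \int[L n]_(z in cball R n) g (Q *m z) = \int[L n]_(z in cball R n) g z.
Proof.
move=> QQT mg; rewrite /Rintegral integral_mkcond [in RHS]integral_mkcond.
congr fine.
rewrite -[RHS](integral_preserved (measurable_mulmxcV Q)
  (fun A => lebesgue_cV_orthogonal (A := A) QQT)).
  apply: eq_integral => z _ /=.
  by rewrite !patchE mem_cball_orthogonal.
apply/(measurable_restrictT _ _).1; first exact: measurable_cball.
exact/measurable_EFinP.
Qed.

Lemma integrable_cball_orthogonal n (Q : 'M[R]_n) (g : 'cV[R]_n -> R) :
  Q *m Q^T = 1%:M -> (L n).-integrable (cball R n) (EFin \o g) ->
  (L n).-integrable (cball R n) (fun z => (g (Q *m z))%:E).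
Proof.
move=> QQT; have mB := @measurable_cball R n.
move=> /(integrable_mkcond _ mB) ig; apply/(integrable_mkcond _ mB).
have := integrable_preserved (measurable_mulmxcV Q)
  (fun A => lebesgue_cV_orthogonal (A := A) QQT) ig.
apply: eq_integrable => // z _ /=.
by rewrite !patchE mem_cball_orthogonal.
Qed.

(** The real-valued integral is [fine] of the extended-real one, so it composes
    with itself only where the inner integral is finite: hence the hypothesis
    on the chords, next to integrability on the whole ball. *)
Lemma Rintegral_cball_fubini m (g : 'cV[R]_m.+1 -> R) :
  (L m.+1).-integrable (cball R m.+1) (EFin \o g) ->
  (forall x, cball R m x -> (@lebesgue_measure R).-integrable (chord x)
     (fun z => (g (concat x z))%:E)) ->
  \int[L m.+1]_(w in cball R m.+1) g w =
  \int[L m]_(x in cball R m) \int[@lebesgue_measure R]_(z in chord x)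
    g (concat x z).
Proof.
move=> ig ich; pose G : 'cV[R]_m.+1 -> \bar R :=
  (EFin \o g) \_ (cball R m.+1).
have mB := @measurable_cball R m.+1.
have mC := @measurable_concat R m.
have iG : (L m.+1).-integrable setT G.
  exact: (integrable_mkcond (EFin \o g) mB).1 ig.
have mG : measurable_fun setT G by exact: measurable_int iG.
(* The sigma-algebra on the second factor is the one lebesgue_measure is built
   on, so that the product measure is a measure on the domain of psi. *)
pose psi (xz : 'cV[R]_m * g_sigma_algebraType (R.-ocitv.-measurable)) :=
  concat xz.1 xz.2.
pose mu : {measure set _ -> \bar R} := (L m \x @lebesgue_measure R)%E.
have iGpsi : mu.-integrable setT (G \o psi).
  apply/integrableP; split; first exact: measurableT_comp.
  case/integrableP: iG => _; apply: le_lt_trans.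
  have := @ge0_integral_pushforward _ _ _ _ _ psi mC
    mu setT (abse \o G) measurableT.
  rewrite preimage_setT => <-//; first exact: measurableT_comp.
  by move=> w _ /=.
rewrite /Rintegral integral_mkcond [in RHS]integral_mkcond; congr fine.
have := @integral_pushforward _ _ _ _ _ psi mC mu setT G mG.
rewrite preimage_setT => /(_ iGpsi measurableT) -> .
rewrite -integral12_prod_meas1//.
apply: eq_integral => x _ /=; rewrite patchE.
have Gconcat z : ~ cball R m.+1 (concat x z) -> G (psi (x, z)) = 0%E.
  by move=> h; rewrite /G patchE memNset.
case: ifPn => [/set_mem|/negP] xB; last first.
  by apply: integral0_eq => z _; apply: Gconcat => /cball_concat[/mem_set].
rewrite /Rintegral fineK; last first.
  apply: integrable_fin_num (ich _ xB); exact: measurable_itv.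
rewrite [RHS]integral_mkcond; apply: eq_integral => z _.
rewrite [RHS]patchE; case: ifPn => [/set_mem|/negP] zx.
  by rewrite /G /= patchE mem_set//; apply/cball_concat.
by apply: Gconcat => /cball_concat[_ /mem_set].
Qed.

(** * Moments and homogeneous polynomials *)

(** Summing over maps from the [l] factors to the coordinates avoids multinomial
    coefficients: every monomial appears once for each of its orderings. *)
Lemma expr_dotp n (z w : 'cV[R]_n) l : dotp z w ^+ l =
  \sum_(phi : {ffun 'I_l -> 'I_n})
    (\prod_k w (phi k) 0) * (\prod_k z (phi k) 0).
Proof.
transitivity (\prod_(k < l) dotp z w); first by rewrite prodr_const card_ord.
under eq_bigr do rewrite dotpE.
rewrite bigA_distr_bigA; apply: eq_bigr => phi _; rewrite -big_split /=.
by apply: eq_bigr => k _; rewrite mulrC.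
Qed.

Lemma integrableMl_bounded n (h f : 'cV[R]_n -> R) (M : R) :
  measurable_fun (cball R n) h ->
  (forall z, cball R n z -> `|h z| <= M) ->
  (L n).-integrable (cball R n) (EFin \o f) ->
  (L n).-integrable (cball R n) (fun z => (h z * f z)%:E).
Proof.
move=> mh hM fi; apply: (integrableMr (@measurable_cball R n) mh) fi.
exists M; split; first exact: num_real.
by move=> M' MM' z zB; apply: le_trans (hM z zB) (ltW MM').
Qed.

Lemma integrable_entries n l (phi : 'I_l -> 'I_n) (f : 'cV[R]_n -> R) :
  (L n).-integrable (cball R n) (EFin \o f) ->
  (L n).-integrable (cball R n) (fun z => ((\prod_k z (phi k) 0) * f z)%:E).
Proof.
apply: (@integrableMl_bounded _ _ _ 1).
  apply: measurable_funTS; apply: measurable_prod => k _.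
  exact: measurable_entry.
move=> z zB; rewrite normr_prod; apply: prodr_ile1 => k.
by rewrite normr_ge0 cball_entry.
Qed.

Lemma integrable_moment n l (w : 'cV[R]_n) (f : 'cV[R]_n -> R) :
  (L n).-integrable (cball R n) (EFin \o f) ->
  (L n).-integrable (cball R n) (fun z => (dotp z w ^+ l * f z)%:E).
Proof.
move=> fi; have mB := @measurable_cball R n.
under eq_fun do rewrite expr_dotp mulr_suml -sumEFin.
apply: integrable_sum => // phi _.
under eq_fun do rewrite -mulrA EFinM.
by apply: integrableZl => //; exact: integrable_entries.
Qed.

(** The expansion separates the variables: the integrals no longer involve [w],
    and are the coefficients of the moment as a polynomial in [w]. *)
Lemma moment_expansion n l (w : 'cV[R]_n) (f : 'cV[R]_n -> R) :
  (L n).-integrable (cball R n) (EFin \o f) ->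
  \int[L n]_(z in cball R n) (dotp z w ^+ l * f z) =
  \sum_(phi : {ffun 'I_l -> 'I_n}) (\prod_k w (phi k) 0) *
    \int[L n]_(z in cball R n) ((\prod_k z (phi k) 0) * f z).
Proof.
move=> fi; have mB := @measurable_cball R n.
have ie phi := integrable_entries (l := l) phi fi.
rewrite /Rintegral.
under eq_integral do rewrite expr_dotp mulr_suml -sumEFin.
rewrite integral_sum//; last first.
  move=> phi; under eq_fun do rewrite -mulrA EFinM.
  exact: integrableZl.
rewrite -[RHS]/(fine _%:E) -sumEFin; congr fine.
apply: eq_bigr => phi _; under eq_integral do rewrite -mulrA EFinM.
rewrite integralZl// EFinM fineK//.
exact: integrable_fin_num (ie _).
Qed.

End BallIntegrals.

Section Homogeneous.
Context {R : realType} (n : nat).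
Implicit Types p q : 'cV[R]_n -> R.

Lemma homogeneous_polynomialM k l p q : homogeneous_polynomial k p ->
  homogeneous_polynomial l q -> homogeneous_polynomial (k + l) (p \* q).
Proof.
move=> [P hP pE] [P' hP' qE]; exists (P * P'); first exact: mpoly.dhomogM.
by move=> w /=; rewrite mpoly.mevalM pE qE.
Qed.

Lemma homogeneous_polynomial_sum (I : Type) (s : seq I) l (c : I -> R)
    (p : I -> 'cV[R]_n -> R) : (forall i, homogeneous_polynomial l (p i)) ->
  homogeneous_polynomial l (fun w => \sum_(i <- s) p i w * c i).
Proof.
move=> hp; elim: s => [|i s [P hP PE]].
  exists 0; first exact: mpoly.dhomog0.
  by move=> w; rewrite big_nil mpoly.meval0.
have [P' hP' PE'] := hp i; exists (c i *: P' + P).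
  by apply: mpoly.dhomogD => //; exact: mpoly.dhomogZ.
by move=> w; rewrite big_cons mpoly.mevalD mpoly.mevalZ -PE -PE' mulrC.
Qed.

Lemma homogeneous_polynomial_entries l (phi : 'I_l -> 'I_n) :
  homogeneous_polynomial l (fun w : 'cV[R]_n => \prod_k w (phi k) 0).
Proof.
elim: l phi => [|l IH] phi.
  exists 1; first exact: mpoly.dhomog1.
  by move=> w; rewrite big_ord0 (rmorph1 (mpoly.meval _)).
under eq_fun do rewrite big_ord_recl.
apply: (@homogeneous_polynomialM 1 l); last exact: IH.
exists (mpoly.mpolyX R (mpoly.mnm1 (phi ord0))).
  by rewrite mpoly.dhomogX; apply/eqP; exact: mpoly.mdeg1.
by move=> w; rewrite mpoly.mevalXU.
Qed.

End Homogeneous.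

(** * Bilinearity in a reproducing kernel Hilbert space *)

Section RkhsLinearity.
Context {R : realType} (X : Type) (K : X -> X -> R) (H : rkhs K).

Lemma rk_space_sum (I : Type) (s : seq I) (F : I -> X -> R) :
  (forall i, rk_space H (F i)) -> rk_space H (\sum_(i <- s) F i).
Proof.
move=> HF; elim: s => [|i s IH]; first by rewrite big_nil; exact: rk_space0.
by rewrite big_cons -[F i]scale1r; exact: rk_space_lin.
Qed.

Lemma rk_dot0l g : rk_space H g -> rk_dot H 0 g = 0.
Proof.
move=> Hg; have H0 := rk_space0 H.
have := rk_dot_lin 1 H0 H0 Hg; rewrite scaler0 addr0 mul1r.
by move/eqP; rewrite -subr_eq subrr eq_sym => /eqP.
Qed.

Lemma rk_spaceZ a f : rk_space H f -> rk_space H (a *: f).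
Proof.
by move=> /(rk_space_lin a) /(_ (rk_space0 H)); rewrite addr0.
Qed.

Lemma rk_dotZr a f g : rk_space H f -> rk_space H g ->
  rk_dot H g (a *: f) = a * rk_dot H g f.
Proof.
move=> Hf Hg; have H0 := rk_space0 H.
rewrite rk_dotC//; last exact: rk_spaceZ.
by rewrite -[a *: f]addr0 rk_dot_lin// rk_dot0l// addr0 rk_dotC.
Qed.

Lemma rk_dot_sumr (I : Type) (s : seq I) (F : I -> X -> R) g :
  (forall i, rk_space H (F i)) -> rk_space H g ->
  rk_dot H g (\sum_(i <- s) F i) = \sum_(i <- s) rk_dot H g (F i).
Proof.
move=> HF Hg; rewrite rk_dotC//; last exact: rk_space_sum.
elim: s => [|i s IH]; first by rewrite !big_nil rk_dot0l.
rewrite !big_cons -{1}[F i]scale1r rk_dot_lin//; last exact: rk_space_sum.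
by rewrite mul1r IH rk_dotC.
Qed.

Lemma rk_dot_tikhonov N M (h : 'I_N -> 'I_M -> X -> R) y nu g :
  (forall i j, rk_space H (h i j)) -> rk_space H g ->
  rk_dot H g (tikhonov_solution H h y nu) =
  \sum_i \sum_j tikhonov_coef H h y nu i j * rk_dot H g (h i j).
Proof.
move=> Hh Hg; have HZ i j : rk_space H (tikhonov_coef H h y nu i j *: h i j).
  exact: rk_spaceZ.
rewrite /tikhonov_solution rk_dot_sumr//; last by move=> i; exact: rk_space_sum.
apply: eq_bigr => i _; rewrite rk_dot_sumr//.
by apply: eq_bigr => j _; rewrite rk_dotZr.
Qed.

End RkhsLinearity.

(** * The X-ray transform *)

Section XRay.
Context {R : realType} (m : nat).
Implicit Types (Q : SO R m.+1) (x : cball R m) (f : cball R m.+1 -> R).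

Lemma SO_orthogonal Q : val Q *m (val Q)^T = 1%:M.
Proof. by have := set_valP Q; case. Qed.

Lemma SO_orthogonal_tr Q : (val Q)^T *m val Q = 1%:M.
Proof. exact/mulmx1C/SO_orthogonal. Qed.

Lemma val_to_cball n (v : 'cV[R]_n) : cball R n v -> val (to_cball v) = v.
Proof. by move=> /mem_set vB; rewrite /to_cball val_insubd vB. Qed.

(** The ray is the line through the foot [eproj_adj Q x] in the direction
    [Q^T e_n]; the two data in the compatibility condition determine it. *)
Lemma rayE Q x z :
  ray Q x z = eproj_adj Q (val x) + z *: ((val Q)^T *m last_axis m).
Proof.
rewrite /ray /eproj_adj scalemxAr -mulmxDr; congr (_ *m _).
apply/colP => i; rewrite !mxE.
case: unliftP => [j ->|->] /=; last by rewrite eqxx mulr1 add0r.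
by rewrite eq_sym (negPf (neq_lift _ _)) mulr0 addr0.
Qed.

(** The half-length of a chord depends only on the distance of its foot from
    the origin, so rays with the same foot have the same parameter interval. *)
Lemma chord_eproj Q x : chord (val x) = chord (eproj_adj Q (val x)).
Proof.
rewrite /chord /eproj_adj orthogonal_dotp ?trmxK ?SO_orthogonal_tr//.
by rewrite dotp_concat mulr0 addr0.
Qed.

Lemma Rintegral_chordN x (g : R -> R) :
  measurable_fun (chord (val x)) g ->
  \int[@lebesgue_measure R]_(z in chord (val x)) g (- z) =
  \int[@lebesgue_measure R]_(z in chord (val x)) g z.
Proof.
move=> mg; rewrite /Rintegral integral_mkcond [in RHS]integral_mkcond.
congr fine.
have mN : measurable_fun setT (-%R : measurableTypeR R -> measurableTypeR R).
  exact: oppr_measurable.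
rewrite -[RHS](integral_preserved mN (@lebesgue_measureN R)).
  apply: eq_integral => z _; rewrite /= !patchE.
  suff -> : (- z \in chord (val x)) = (z \in chord (val x)) by [].
  by apply/idP/idP; rewrite !inE /chord /= !in_itv /= -!ler_norml normrN.
apply/(measurable_restrictT _ _).1; first exact: measurable_itv.
exact/measurable_EFinP.
Qed.

(** Opposite directions make the second ray the first one run backwards, and a
    chord is symmetric about its foot. *)
Lemma hl_compatibility_xray f :
  (forall Q x, (@lebesgue_measure R).-integrable (chord (val x))
     (fun z => (f (to_cball (ray Q x z)))%:E)) ->
  hl_compatibility (xray f).
Proof.
move=> fi Q1 Q2 x1 x2 e12 p12.
have chE : chord (val x1) = chord (val x2).
  by rewrite (chord_eproj Q1) (chord_eproj Q2) p12.
rewrite /xray chE; case: e12 => e12.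
  by apply: eq_Rintegral => z _; rewrite !rayE e12 p12.
rewrite -[RHS]Rintegral_chordN; last first.
  by apply/measurable_EFinP; exact: measurable_int (fi Q2 x2).
by apply: eq_Rintegral => z _; rewrite !rayE e12 p12 scalerN scaleNr.
Qed.

(** Fubini's theorem assembles the slices into an integral over the n-ball, and
    the substitution by [Q] moves the rotation from [f] to the direction. *)
Lemma slice_moment_xray f l Q (v : 'cV[R]_m) :
  (forall x, (@lebesgue_measure R).-integrable (chord (val x))
     (fun z => (f (to_cball (ray Q x z)))%:E)) ->
  (@lebesgue_cV R m.+1).-integrable (cball R m.+1)
    (fun z => (f (to_cball z))%:E) ->
  slice_moment (xray f Q) l v = ball_moment f l (eproj_adj Q v).
Proof.
move=> fchord fball.
have QTQ : (val Q)^T *m ((val Q)^T)^T = 1%:M by rewrite trmxK SO_orthogonal_tr.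
(* In the coordinates w = Q u of the slices this integrand becomes that of the
   slice moment (gconcat below): Q^T is an isometry, and the last entry of
   concat v 0 vanishes. *)
pose g u := dotp u (eproj_adj Q v) ^+ l * f (to_cball u).
have gi : (@lebesgue_cV R m.+1).-integrable (cball R m.+1) (EFin \o g).
  exact: (integrable_moment l (eproj_adj Q v) (f := f \o @to_cball _ _)).
have mg : measurable_fun (cball R m.+1) g.
  by apply/measurable_EFinP; exact: measurable_int gi.
have chordi (x : 'cV[R]_m) : cball R m x ->
    (@lebesgue_measure R).-integrable (chord x)
      (fun z => (f (to_cball ((val Q)^T *m concat x z)))%:E).
  by move=> xB; have := fchord (to_cball x); rewrite /ray val_to_cball.
have gconcat (x : 'cV[R]_m) z : g ((val Q)^T *m concat x z) =
    dotp x v ^+ l * f (to_cball ((val Q)^T *m concat x z)).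
  by rewrite /g /eproj_adj orthogonal_dotp// dotp_concat mulr0 addr0.
rewrite /ball_moment -[RHS](Rintegral_cball_orthogonal QTQ mg).
rewrite Rintegral_cball_fubini; last 2 first.
- exact: integrable_cball_orthogonal QTQ gi.
- move=> x xB; under eq_fun do rewrite gconcat EFinM.
  by apply: integrableZl; [exact: measurable_itv|exact: chordi].
apply: eq_Rintegral => x /set_mem xB.
under [RHS]eq_Rintegral do rewrite gconcat.
rewrite RintegralZl//; [|exact: measurable_itv|exact: chordi].
by rewrite /xray /ray val_to_cball.
Qed.

Lemma homogeneous_ball_moment f l :
  (@lebesgue_cV R m.+1).-integrable (cball R m.+1)
    (fun z => (f (to_cball z))%:E) ->
  homogeneous_polynomial l (ball_moment f l).
Proof.
move=> fi; have E w := moment_expansion l w (f := f \o @to_cball _ _) fi.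
rewrite /ball_moment (funext E).
apply: homogeneous_polynomial_sum => phi.
exact: homogeneous_polynomial_entries.
Qed.

End XRay.

Theorem proposition3p11 (R : realType) (m : nat) (m_gt0 : (0 < m)%N)
    (K : cball R m.+1 -> cball R m.+1 -> R) (HK : reproducing_kernel K)
    (H : rkhs K) (Hind : forall Q : SO R m.+1, rkhs (induced_kernel K Q))
    (integrals : integrals_exist H)
    (xray_bounded : forall Q : SO R m.+1,
       bounded_operator H (Hind Q) (fun f => xray f Q))
    (xray_adj : SO R m.+1 -> (cball R m -> R) -> (cball R m.+1 -> R))
    (xray_adjP : forall Q : SO R m.+1,
       hilbert_adjoint H (Hind Q) (fun f => xray f Q) (xray_adj Q))
    (N M : nat) (Qs : 'I_N -> SO R m.+1) (xs : 'I_M -> cball R m)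
    (y : 'I_N -> 'I_M -> R) (nu : R) (nu_gt0 : 0 < nu) :
  let rep (Q : SO R m.+1) (x : cball R m) : cball R m.+1 -> R :=
    xray_adj Q (fun x' => induced_kernel K Q x' x) in
  let h (i : 'I_N) (j : 'I_M) := rep (Qs i) (xs j) in
  let alpha := tikhonov_coef H h y nu in
  let fhat := tikhonov_solution H h y nu in
  [/\ forall (Q : SO R m.+1) (x : cball R m),
        xray fhat Q x = rk_dot H (rep Q x) fhat /\
        rk_dot H (rep Q x) fhat =
          \sum_(i < N) \sum_(j < M) alpha i j * rk_dot H (rep Q x) (h i j),
      forall Q : SO R m.+1, rk_space (Hind Q) (xray fhat Q),
      helgason_ludwig (xray fhat)
    & forall l : nat, homogeneous_polynomial l (ball_moment fhat l) /\
        forall (Q : SO R m.+1) (v : 'cV[R]_m),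
          slice_moment (xray fhat Q) l v = ball_moment fhat l (eproj_adj Q v)].
Proof.
move=> rep h alpha fhat.
have repH Q x : rk_space H (rep Q x).
  by have [adjH _] := xray_adjP Q; apply: adjH; exact: rk_kernel.
have hH i j : rk_space H (h i j) by exact: repH.
have fhatH : rk_space H fhat by exact: tikhonov_solution_space.
have [chordi _ balli] := integrals.
have xrayH Q : rk_space (Hind Q) (xray fhat Q).
  by have [xrayH _ _] := xray_bounded Q; exact: xrayH.
have slice l Q v : slice_moment (xray fhat Q) l v =
    ball_moment fhat l (eproj_adj Q v).
  by apply: slice_moment_xray => [x|]; [exact: chordi|exact: balli].
have hom l : homogeneous_polynomial l (ball_moment fhat l).
  by apply: homogeneous_ball_moment; exact: balli.
split=> //.
- move=> Q x; split; last exact: rk_dot_tikhonov.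
  have [_ adj] := xray_adjP Q.
  rewrite (rk_reproducing x (xrayH Q)) adj//; last exact: rk_kernel.
  exact: (rk_dotC fhatH (repH Q x)).
- split; first by apply: hl_compatibility_xray => Q x; exact: chordi.
  by move=> l; exists (ball_moment fhat l).
Qed.
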